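(* Let $n\ge 1$ and $k\ge 1$ be integers and let $r\geq 1$ be real. Let $p^*\in\Delta_k$ be a maximizer of $$E_{r,n}(p)=\sum_{u} p^r(u)(1-p(u))^n$$ over $p\in\Delta_k$. Let $$t^*=\frac{r}{r+n},\qquad t_1=t^*-\frac{1}{r+n}\sqrt{\frac{rn}{r+n-1}},\qquad t_2=t^*+\frac{1}{r+n}\sqrt{\frac{rn}{r+n-1}} .$$ Then the following hold. 1. $p^*(u)=p^*(v)$ for all symbols $u,v$ with $p^*(u),p^*(v)\in[t_1,t_2]$. 2. There exists at most a single symbol $u$ such that $p^*(u)\in(0,t_1)$. 3. There exists at most a single symbol $u$ such that $p^*(u)\in(t_2,1]$.
   Context: $\Delta_k$ denotes the set of all probability distributions over an alphabet of size $k$ (some symbols may have probability $0$). The sum in $E_{r,n}(p)$ runs over all $k$ symbols $u$ of the alphabet, and $p^r(u)$ means $(p(u))^r$. *)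

(* Defs.v *)
From HB Require Import structures.
From mathcomp Require Import all_boot all_order all_algebra.
From mathcomp Require Import all_classical all_reals all_analysis.

Set Implicit Arguments.
Unset Strict Implicit.
Unset Printing Implicit Defensive.

Import Order.TTheory GRing.Theory Num.Theory.

Local Open Scope ring_scope.
Local Open Scope classical_set_scope.

Definition simplex (R : realType) (T : finType) : set (T -> R) :=
  [set p | (forall u, 0 <= p u) /\ \sum_(u : T) p u = 1].

(* The exponent r is real, hence powR; the terms with p u = 0 vanish because
   0 `^ r = 0 for r != 0. *)
Definition Ern (R : realType) (T : finType) (r : R) (n : nat) (p : T -> R) : R :=
  \sum_(u : T) (p u) `^ r * (1 - p u) ^+ n.

Definition is_maximizer (R : realType) (X : Type) (A : set X) (F : X -> R)
    (x : X) : Prop :=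
  A x /\ forall y, A y -> F y <= F x.

Definition tstar (R : realType) (r : R) (n : nat) : R := r / (r + n%:R).

Definition t1 (R : realType) (r : R) (n : nat) : R :=
  tstar r n - (r + n%:R)^-1 * Num.sqrt (r * n%:R / (r + n%:R - 1)).

Definition t2 (R : realType) (r : R) (n : nat) : R :=
  tstar r n + (r + n%:R)^-1 * Num.sqrt (r * n%:R / (r + n%:R - 1)).

(* Main.v *)
Require Import Defs.
From HB Require Import structures.
From mathcomp Require Import all_boot all_order all_algebra.
From mathcomp Require Import all_classical all_reals normedtype.
(* Imported ahead of the other analysis files, so that the normed structure they
   state their lemmas with takes precedence over a later duplicate instance. *)
Import numFieldNormedType.Exports.
From mathcomp Require Import all_analysis.
From mathcomp Require Import ring lra.

(** Write [E_{r,n}(p) = \sum_u phi (p u)] with [phi x = x^r (1 - x)^n].  The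
    theorem reflects the shape of [phi] on [0, 1]: on the open interval
    [x^2 (1 - x)^2 phi'' x = phi x * q x], where [q] is a quadratic with
    positive leading coefficient whose roots are exactly [t1] and [t2]
    ([beta_kernel_d2E]).  Hence [phi] is strictly convex below [t1], strictly
    concave between [t1] and [t2], and strictly convex above [t2].

    Since [E] is a sum of one-symbol terms, a maximizer cannot be improved by
    moving mass between two symbols ([maximizer_transfer]).  If two symbols had
    distinct probabilities in [[t1, t2]], replacing both by their mean would
    increase [E] by strict concavity.  If two symbols had probabilities inside
    the same convex region, taking a little mass from the smaller one and giving
    it to the larger one would increase [E] by strict convexity.

    Both moves are instances of one fact: a function with positive second
    derivative grows more over the second of two intervals of the same length
    ([ltr_increment]).  It asks for derivatives only in the open interval, so
    that the moves may reach 0, where [phi] need not be differentiable: [t1] is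
    0 for [r = 1], and the mass of a symbol below [t1] may have to be given away
    entirely. *)

Set Implicit Arguments.
Unset Strict Implicit.
Unset Printing Implicit Defensive.

Import Order.TTheory GRing.Theory Num.Theory.

Local Open Scope classical_set_scope.
Local Open Scope ring_scope.

(** * Increments of a strictly convex function *)

(** The mean value theorem produces slopes at two points [c < d], and once more
    on [c, d] it shows that the slope at [d] is the larger.  The two intervals
    may have a gap between them. *)
Lemma ltr_increment (R : realType) (f f' f'' : R -> R) (x y z w : R) :
  x < y -> y <= z -> y - x = w - z ->
  {within `[x, w]%classic, continuous f} ->
  (forall c, c \in `]x, w[ -> is_derive c 1 f (f' c)) ->
  (forall c, c \in `]x, w[ -> is_derive c 1 f' (f'' c)) ->
  (forall c, c \in `]x, w[ -> 0 < f'' c) ->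
  f y - f x < f w - f z.
Proof.
move=> xy yz eqlen fcont df ddf ddf_gt0.
have zw : z < w by rewrite -subr_gt0 -eqlen subr_gt0.
have yw : y <= w by apply: le_trans yz (ltW zw).
have xz : x <= z by apply: le_trans (ltW xy) yz.
have sub a b c : x <= a -> b <= w -> c \in `]a, b[ -> c \in `]x, w[.
  by move=> xa bw; rewrite !in_itv/=; lra.
have fcont_sub a b : x <= a -> b <= w -> {within `[a, b]%classic, continuous f}.
  move=> xa bw; apply: continuous_subspaceW fcont.
  by apply: subset_itv; rewrite bnd_simp.
have df_sub a b : x <= a -> b <= w ->
    forall t, t \in `]a, b[ -> is_derive t 1 f (f' t).
  by move=> xa bw t tI; exact/df/(sub a b).
have [c cxy ->] := MVT xy (df_sub _ _ (lexx x) yw) (fcont_sub _ _ (lexx x) yw).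
have [d dzw ->] := MVT zw (df_sub _ _ xz (lexx w)) (fcont_sub _ _ xz (lexx w)).
have cd : c < d by move: cxy dzw; rewrite !in_itv/=; lra.
have cdS t : t \in `[c, d] -> t \in `]x, w[.
  by move: cxy dzw; rewrite !in_itv/=; lra.
have ddf_cd t : t \in `]c, d[ -> is_derive t 1 f' (f'' t).
  by move=> tcd; apply: ddf; apply: cdS; apply: subset_itv_oo_cc tcd.
have f'cont : {within `[c, d], continuous f'}.
  apply: derivable_within_continuous => t /cdS tS.
  by have dt := ddf t tS; apply: ex_derive.
have [e ecd eqe] := MVT cd ddf_cd f'cont.
rewrite eqlen ltr_pM2r ?subr_gt0// -subr_gt0 eqe mulr_gt0 ?subr_gt0//.
by apply: ddf_gt0; apply: cdS; apply: subset_itv_oo_cc ecd.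
Qed.

(** * The function x^a (1 - x)^m and its second derivative *)

Definition beta_kernel (R : realType) (a : R) (m : nat) (x : R) : R :=
  x `^ a * (1 - x) ^+ m.

Definition beta_kernel_d1 (R : realType) (a : R) (m : nat) (x : R) : R :=
  a * beta_kernel (a - 1) m x - m%:R * beta_kernel a m.-1 x.

Definition beta_kernel_d2 (R : realType) (a : R) (m : nat) (x : R) : R :=
  a * beta_kernel_d1 (a - 1) m x - m%:R * beta_kernel_d1 a m.-1 x.

Section BetaKernel.
Variable R : realType.
Implicit Types (a x r : R) (m n : nat).

Lemma is_derive_onemX m x :
  is_derive x 1 (fun t : R => (1 - t) ^+ m) (- (m%:R * (1 - x) ^+ m.-1)).
Proof.
have dlin : is_derive x (1 : R) (cst (1 : R) - id) (0 - 1) by apply: is_deriveB.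
have dX := is_deriveX m dlin.
rewrite (_ : (fun t => _) = (cst 1 - id) ^+ m); last first.
  by apply/funext => t; rewrite !fctE.
by apply: (is_derive_eq dX); rewrite /GRing.scale/= !fctE/=; ring.
Qed.

Lemma is_derive_beta_kernel a m x : 0 < x ->
  is_derive x 1 (beta_kernel a m) (beta_kernel_d1 a m x).
Proof.
move=> x0; have dpow := is_derive1_powR a x0.
have := is_deriveM dpow (is_derive_onemX m x).
rewrite (_ : (@powR R ^~ a) * _ = beta_kernel a m); last first.
  by apply/funext => t; rewrite /beta_kernel !fctE.
move=> dprod; apply: (is_derive_eq dprod).
by rewrite /beta_kernel_d1 /beta_kernel /GRing.scale/=; ring.
Qed.

Lemma is_derive_beta_kernel_d1 a m x : 0 < x ->
  is_derive x 1 (beta_kernel_d1 a m) (beta_kernel_d2 a m x).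
Proof.
move=> x0.
have dl := is_deriveZ a (is_derive_beta_kernel (a - 1) m x0).
have dr := is_deriveZ m%:R (is_derive_beta_kernel a m.-1 x0).
exact: is_deriveB dl dr.
Qed.

Lemma beta_kernel_within_continuous a m x y : 0 < a -> 0 <= x ->
  {within `[x, y]%classic, continuous (beta_kernel a m)}.
Proof.
move=> a0 x0.
have cpos t : 0 < t -> {for t, continuous (beta_kernel a m)}.
  move=> t0; apply/differentiable_continuous/derivable1_diffP.
  by have dt := is_derive_beta_kernel a m t0; apply: ex_derive.
have [xy|yx|<-] := ltgtP x y; last 2 first.
- rewrite set_itv_ge ?bnd_simp -?ltNge//; exact: continuous_subspace0.
- rewrite set_itv1; exact: continuous_subspace1.
apply/continuous_within_itvP => //; split=> [t| |].
- by rewrite in_itv/= => /andP[xt _]; apply: cpos; apply: le_lt_trans xt.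
- have [x_gt0|] := ltrP 0 x; first exact/cvg_at_right_filter/cpos.
  move=> x_le0; have {x_le0 x0 xy} -> : x = 0 by apply/eqP; rewrite eq_le x_le0.
  rewrite /beta_kernel; apply: cvgM.
    rewrite powR0 ?gt_eqF//; exact: powR_cvg0.
  have onemX_cont : {for 0, continuous (fun t : R => (1 - t) ^+ m)}.
    apply/differentiable_continuous/derivable1_diffP.
    by have dt := is_derive_onemX m 0; apply: ex_derive.
  exact: cvg_at_right_filter onemX_cont.
- by apply/cvg_at_left_filter/cpos; apply: le_lt_trans xy.
Qed.

(** The radicand in [t1] and [t2] comes from
    [r^2 (r + n - 1) - r (r - 1) (r + n) = r n]. *)
Lemma quadratic_t1t2 r n x : 1 <= r -> (1 <= n)%N ->
  (r + n%:R) * (r + n%:R - 1) * ((x - t1 r n) * (x - t2 r n)) =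
  r * (r - 1) * (1 - x) ^+ 2 - 2 * r * n%:R * (x * (1 - x))
  + n%:R * (n%:R - 1) * x ^+ 2.
Proof.
move=> r1 n1; have n1R : 1 <= n%:R :> R by rewrite ler1n.
set s := r * n%:R / (r + n%:R - 1).
have s0 : 0 <= s by apply: divr_ge0; [apply: mulr_ge0|]; lra.
have -> : (x - t1 r n) * (x - t2 r n) =
    (x - tstar r n) ^+ 2 - (r + n%:R)^-1 ^+ 2 * s.
  by rewrite -[in RHS](sqr_sqrtr s0) /t1 /t2 -/s; ring.
by rewrite /s /tstar; field; apply/andP; split; apply: lt0r_neq0; lra.
Qed.

(** The factor [(x (1 - x))^2] makes up for the exponents [r - 2] and [n - 2] in
    the second derivative; the resulting identity also covers [n = 1], where the
    term with the exponent [n - 2] has the coefficient [n (n - 1) = 0]. *)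
Lemma beta_kernel_d2E r n x : 1 <= r -> (1 <= n)%N -> 0 < x ->
  beta_kernel_d2 r n x * (x * (1 - x)) ^+ 2 =
  beta_kernel r n x *
  ((r + n%:R) * (r + n%:R - 1) * ((x - t1 r n) * (x - t2 r n))).
Proof.
move=> r1 n1 x0; rewrite quadratic_t1t2//.
have xa a : x `^ a = x * x `^ (a - 1).
  rewrite -[in LHS](subrK 1 a) [LHS]powRD; last by rewrite (gt_eqF x0) implybT.
  by rewrite powRr1 ?ltW// mulrC.
rewrite /beta_kernel_d2 /beta_kernel_d1 /beta_kernel (xa r) (xa (r - 1)).
case: n n1 => [//|[|n]] _ /=; rewrite ?exprS ?expr0 -?[in n.+2%:R]natr1 -?natr1.
  by ring.
by ring.
Qed.

End BetaKernel.

(** * Convexity and concavity on either side of the roots *)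

Section Comparison.
Variables (R : realType) (r : R) (n : nat).
Hypotheses (r1 : 1 <= r) (n1 : (1 <= n)%N).
Implicit Types (x y z w : R).

Let n1R : 1 <= n%:R :> R. Proof. by rewrite ler1n. Qed.

Let r0 : 0 < r. Proof. exact: lt_le_trans ltr01 r1. Qed.

Lemma sgr_beta_kernel_d2 x : 0 < x < 1 ->
  Num.sg (beta_kernel_d2 r n x) = Num.sg ((x - t1 r n) * (x - t2 r n)).
Proof.
move=> /andP[x0 x1].
have sq_gt0 : 0 < (x * (1 - x)) ^+ 2 by rewrite exprn_gt0// mulr_gt0// subr_gt0.
have phi_gt0 : 0 < beta_kernel r n x.
  by rewrite mulr_gt0 ?powR_gt0// exprn_gt0// subr_gt0.
have lead_gt0 : 0 < (r + n%:R) * (r + n%:R - 1).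
  by apply: mulr_gt0; move: n1R r1; lra.
have := congr1 Num.sg (beta_kernel_d2E r1 n1 x0).
by rewrite sgrM (gtr0_sg sq_gt0) mulr1 [RHS]sgrM (gtr0_sg phi_gt0) mul1r
  [RHS]sgrM (gtr0_sg lead_gt0) mul1r.
Qed.

(** Where the quadratic is positive, the kernel is strictly convex: the sum of
    two values increases when the arguments move apart with a fixed sum. *)
Lemma beta_kernel_spread x y z w :
  0 <= x -> w <= 1 -> x < y -> y <= z -> y - x = w - z ->
  (forall c, c \in `]x, w[ -> 0 < (c - t1 r n) * (c - t2 r n)) ->
  beta_kernel r n y + beta_kernel r n z < beta_kernel r n x + beta_kernel r n w.
Proof.
move=> x0 w1 xy yz eqlen q_gt0.
have in01 c : c \in `]x, w[ -> 0 < c < 1 by rewrite in_itv/=; lra.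
suff : beta_kernel r n y - beta_kernel r n x <
    beta_kernel r n w - beta_kernel r n z by lra.
apply: (ltr_increment xy yz eqlen (beta_kernel_within_continuous r0 x0)).
- by move=> c /in01/andP[c0 _]; exact: is_derive_beta_kernel.
- by move=> c /in01/andP[c0 _]; exact: is_derive_beta_kernel_d1.
- by move=> c cI; rewrite -sgr_gt0 sgr_beta_kernel_d2 ?in01// sgr_gt0 q_gt0.
Qed.

(** Strict concavity; the increments of the opposite function are compared on
    both sides of the midpoint. *)
Lemma beta_kernel_midpoint x y : 0 <= x -> y <= 1 -> x < y ->
  (forall c, c \in `]x, y[ -> (c - t1 r n) * (c - t2 r n) < 0) ->
  beta_kernel r n x + beta_kernel r n y < beta_kernel r n ((x + y) / 2) *+ 2.
Proof.
move=> x0 y1 xy q_lt0.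
have in01 c : c \in `]x, y[ -> 0 < c < 1 by rewrite in_itv/=; lra.
set m := (x + y) / 2; set phi := beta_kernel r n.
suff : (- phi) m - (- phi) x < (- phi) y - (- phi) m.
  by rewrite !fctE mulr2n; lra.
have phi_cont : {within `[x, y], continuous (- phi)}.
  by move=> t; apply/continuousN/beta_kernel_within_continuous.
have xm : x < m by rewrite /m; lra.
have eqlen : m - x = y - m by rewrite /m; lra.
apply: (ltr_increment xm (lexx m) eqlen phi_cont).
- by move=> c /in01/andP[c0 _]; apply: is_deriveN; exact: is_derive_beta_kernel.
- move=> c /in01/andP[c0 _]; apply: is_deriveN.
  exact: is_derive_beta_kernel_d1.
- move=> c cI; rewrite oppr_gt0.
  by rewrite -sgr_lt0 sgr_beta_kernel_d2 ?in01// sgr_lt0 q_lt0.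
Qed.

Let rn_gt0 : 0 < r + n%:R. Proof. by rewrite addr_gt0// ltr0n. Qed.

Let half_width_ge0 :
  0 <= (r + n%:R)^-1 * Num.sqrt (r * n%:R / (r + n%:R - 1)).
Proof. by rewrite mulr_ge0 ?sqrtr_ge0// invr_ge0 ltW. Qed.

Lemma t2_gt0 : 0 < t2 r n.
Proof. by rewrite ltr_wpDr// divr_gt0. Qed.

Lemma t1_le_t2 : t1 r n <= t2 r n.
Proof. by move: half_width_ge0; rewrite /t1 /t2; lra. Qed.

End Comparison.

(** * Moving mass between two symbols of a maximizer *)

(** Only the two terms of the symbols involved change, and the total mass stays
    1, so that optimality bounds the change of these two terms. *)
Lemma maximizer_transfer (R : realType) (T : finType) (r : R) (n : nat)
    (p : T -> R) (u v : T) (x y : R) :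
  is_maximizer (@simplex R T) (Ern r n) p -> u != v ->
  0 <= x -> 0 <= y -> x + y = p u + p v ->
  beta_kernel r n x + beta_kernel r n y <=
  beta_kernel r n (p u) + beta_kernel r n (p v).
Proof.
move=> [[p0 p1] pmax] uv x0 y0 xy.
pose p' t := if t == u then x else if t == v then y else p t.
have split2 (F : R -> R) (q : T -> R) : \sum_t F (q t) =
    F (q u) + F (q v) + \sum_(t | (t != u) && (t != v)) F (q t).
  by rewrite (bigD1 u)//= (bigD1 v)/= ?addrA// eq_sym.
have p'u : p' u = x by rewrite /p' eqxx.
have p'v : p' v = y by rewrite /p' eq_sym (negbTE uv) eqxx.
have rest (F : R -> R) : \sum_(t | (t != u) && (t != v)) F (p' t) =
    \sum_(t | (t != u) && (t != v)) F (p t).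
  by apply: eq_bigr => t /andP[/negbTE tu /negbTE tv]; rewrite /p' tu tv.
have p'S : simplex p'.
  split=> [t|]; first by rewrite /p'; case: eqP => // _; case: eqP.
  by rewrite (split2 id p') (rest id) p'u p'v /= xy -(split2 id p).
have := pmax p' p'S; rewrite /Ern -!/(beta_kernel r n _).
rewrite (split2 (beta_kernel r n) p') (split2 (beta_kernel r n) p) rest.
by rewrite p'u p'v lerD2r.
Qed.

Lemma simplex_pair_le1 (R : realType) (T : finType) (p : T -> R) (u v : T) :
  simplex p -> u != v -> p u + p v <= 1.
Proof.
move=> [p0 <-] uv; rewrite (bigD1 u)//= (bigD1 v) 1?eq_sym//= addrA lerDl.
by apply: sumr_ge0 => t _; exact: p0.
Qed.

(** The room [p v + d <= 1] that the larger symbol needs is automatic, because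
    [p u + p v <= 1] and [d <= p u]. *)
Lemma maximizer_no_spread (R : realType) (T : finType) (r : R) (n : nat)
    (p : T -> R) (u v : T) (d : R) :
  1 <= r -> (1 <= n)%N -> is_maximizer (@simplex R T) (Ern r n) p -> u != v ->
  p u <= p v -> 0 < d -> d <= p u ->
  ~ (forall c, c \in `]p u - d, p v + d[ -> 0 < (c - t1 r n) * (c - t2 r n)).
Proof.
move=> r1 n1 pmax uv puv d0 du q_gt0.
have pv1 : p v + d <= 1 by have := simplex_pair_le1 pmax.1 uv; lra.
have x0 : 0 <= p u - d by lra.
have y0 : 0 <= p v + d by lra.
have xu : p u - d < p u by lra.
have len : p u - (p u - d) = p v + d - p v by lra.
have mass : p u - d + (p v + d) = p u + p v by lra.
have := beta_kernel_spread r1 n1 x0 pv1 xu puv len q_gt0.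
by rewrite ltNge (maximizer_transfer pmax uv x0 y0 mass).
Qed.

Theorem theorem2 (R : realType) (n k : nat) (r : R) (T : finType)
    (hn : (1 <= n)%N) (hk : (1 <= k)%N) (hr : 1 <= r) (hT : #|T| = k)
    (p : T -> R) (hp : is_maximizer (@simplex R T) (Ern r n) p) :
  [/\ forall u v : T, p u \in `[t1 r n, t2 r n] -> p v \in `[t1 r n, t2 r n] ->
        p u = p v,
      forall u v : T, p u \in `]0, t1 r n[ -> p v \in `]0, t1 r n[ -> u = v
    & forall u v : T, p u \in `]t2 r n, 1] -> p v \in `]t2 r n, 1] -> u = v].
Proof.
have t12 := t1_le_t2 hr hn; have t2_0 := t2_gt0 hr hn.
have p0 u : 0 <= p u := hp.1.1 u.
split=> u v.
- wlog puv : u v / p u < p v => [hwlog Iu Iv|].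
    by have [/hwlog|/hwlog/(_ Iv Iu)/esym|] := ltgtP (p u) (p v); apply.
  rewrite !in_itv/= => /andP[u1 u2] /andP[v1 v2].
  have uv : u != v by apply: contraTneq puv => ->; rewrite ltxx.
  have pv1 : p v <= 1 by have := simplex_pair_le1 hp.1 uv; have := p0 u; lra.
  have q_lt0 c : c \in `]p u, p v[ -> (c - t1 r n) * (c - t2 r n) < 0.
    by rewrite in_itv/= => /andP[uc cv]; rewrite pmulr_rlt0; lra.
  have mid0 : 0 <= (p u + p v) / 2 by have := p0 u; have := p0 v; lra.
  have mass : (p u + p v) / 2 + (p u + p v) / 2 = p u + p v by lra.
  have := beta_kernel_midpoint hr hn (p0 u) pv1 puv q_lt0.
  by rewrite mulr2n ltNge (maximizer_transfer hp uv mid0 mid0 mass).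
- wlog puv : u v / p u <= p v => [hwlog Iu Iv|].
    by have [/hwlog|/ltW/hwlog/(_ Iv Iu)/esym] := leP (p u) (p v); apply.
  rewrite !in_itv/= => /andP[u0 u1] /andP[v0 v1]; apply/eqP/negPn/negP => uv.
  (* The shift stops when the smaller mass reaches 0 or the larger one [t1]. *)
  pose d := Num.min (p u) (t1 r n - p v).
  have d0 : 0 < d by rewrite lt_min u0 subr_gt0.
  have du : d <= p u by rewrite ge_min lexx.
  have dv : d <= t1 r n - p v by rewrite ge_min lexx orbT.
  apply: (maximizer_no_spread hr hn hp uv puv d0 du) => c.
  by rewrite in_itv/= => /andP[_ cv]; rewrite nmulr_rgt0; lra.
- wlog puv : u v / p u <= p v => [hwlog Iu Iv|].
    by have [/hwlog|/ltW/hwlog/(_ Iv Iu)/esym] := leP (p u) (p v); apply.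
  rewrite !in_itv/= => /andP[u2 u1] /andP[v2 v1]; apply/eqP/negPn/negP => uv.
  (* This shift brings the smaller mass exactly down to [t2]. *)
  have d0 : 0 < p u - t2 r n by rewrite subr_gt0.
  have du : p u - t2 r n <= p u by lra.
  apply: (maximizer_no_spread hr hn hp uv puv d0 du) => c.
  by rewrite in_itv/= => /andP[uc _]; rewrite mulr_gt0//; lra.
Qed.
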